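(* Let $j$ and $m$ be integers and $n$ a non-negative integer. Then \[ \sum_{k=0}^n\binom{n}{k}\frac{F_{jk+m}}{L_j^k}B_{n-k}=\begin{cases}F_mB_n\big(\frac{\alpha^j}{L_j}\big), & n \text{ even},\\[4pt] \frac{L_m}{\sqrt5}B_n\big(\frac{\alpha^j}{L_j}\big), & n\text{ odd},\end{cases} \qquad \sum_{k=0}^n\binom{n}{k}\frac{L_{jk+m}}{L_j^k}B_{n-k}=\begin{cases}L_mB_n\big(\frac{\alpha^j}{L_j}\big), & n \text{ even},\\[4pt] \sqrt5F_mB_n\big(\frac{\alpha^j}{L_j}\big), & n\text{ odd}.\end{cases} \]
   Context: $\alpha=\frac{1+\sqrt5}{2}$, $\beta=\frac{1-\sqrt5}{2}$. For every integer $s$, $F_s=\frac{\alpha^s-\beta^s}{\sqrt5}$ and $L_s=\alpha^s+\beta^s$ (Fibonacci and Lucas numbers extended to all integers; $L_s\neq0$ for all $s$). The Bernoulli polynomials $B_n(x)$ are defined by $\sum_{n\ge0}B_n(x)\frac{z^n}{n!}=\frac{ze^{xz}}{e^z-1}$, and $B_n=B_n(0)$. *)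

(* Defs.v *)
From mathcomp Require Import all_boot all_order all_algebra.
Set Implicit Arguments.
Unset Strict Implicit.
Unset Printing Implicit Defensive.
Import Order.TTheory GRing.Theory Num.Theory.
Local Open Scope ring_scope.

Section FibonacciLucas.
Variable R : rcfType.

Definition alpha : R := (1 + Num.sqrt 5) / 2.
Definition beta : R := (1 - Num.sqrt 5) / 2.

Definition fibz (s : int) : R := (alpha ^ s - beta ^ s) / Num.sqrt 5.
Definition lucasz (s : int) : R := alpha ^ s + beta ^ s.

End FibonacciLucas.

Arguments alpha {R}.
Arguments beta {R}.
Arguments fibz {R} s.
Arguments lucasz {R} s.

(* A formal power series in z over A is its sequence of coefficients. *)
Section FormalPowerSeries.
Variable A : comUnitRingType.
Implicit Types f g h : nat -> A.

Definition fps_z : nat -> A := fun n => (n == 1%N)%:R.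

Definition fps_mul f g : nat -> A :=
  fun n => \sum_(i < n.+1) f i * g (n - i)%N.

(* exp (x z) *)
Definition fps_exp (x : A) : nat -> A := fun n => x ^+ n / n`!%:R.

(* exp z - 1 *)
Definition fps_expm1 : nat -> A := fun n => fps_exp 1 n - (n == 0%N)%:R.

(* The first n coefficients of f / g, for g 0 a unit, obtained by solving
   h * g = f one coefficient at a time. *)
Fixpoint fps_div_seq f g n : seq A :=
  if n is n'.+1 then
    let s := fps_div_seq f g n' in
    rcons s ((f n' - \sum_(i < n') s`_i * g (n' - i)%N) / g 0%N)
  else [::].

Definition fps_div f g : nat -> A := fun n => (fps_div_seq f g n.+1)`_n.

Lemma size_fps_div_seq f g n : size (fps_div_seq f g n) = n.
Proof. by elim: n => //= n IHn; rewrite size_rcons IHn. Qed.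

Lemma nth_fps_div_seq f g n i :
  (i < n)%N -> (fps_div_seq f g n)`_i = fps_div f g i.
Proof.
elim: n => // n IHn; rewrite ltnS leq_eqVlt => /orP[/eqP -> //|lt_in].
by rewrite /= nth_rcons size_fps_div_seq lt_in IHn.
Qed.

Lemma fps_divE f g n :
  fps_div f g n =
  (f n - \sum_(i < n) fps_div f g i * g (n - i)%N) / g 0%N.
Proof.
rewrite {1}/fps_div /= nth_rcons size_fps_div_seq ltnn eqxx.
by under eq_bigr => i _ do rewrite nth_fps_div_seq //.
Qed.

Lemma fps_mul_div f g :
  g 0%N \is a GRing.unit -> fps_mul (fps_div f g) g =1 f.
Proof.
move=> g0 n; rewrite /fps_mul big_ord_recr /= subnn.
by rewrite (fps_divE f g n) divrK // addrC subrK.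
Qed.

End FormalPowerSeries.

Section Bernoulli.
Variable R : rcfType.

(* B_n(X) / n! is the coefficient of z^n in z exp (X z) / (exp z - 1); as
   exp z - 1 has no constant term, a factor z is cancelled first, the
   denominator (exp z - 1) / z being the shift of exp z - 1. *)
Definition bernoulli_poly (n : nat) : {poly R} :=
  n`!%:R * fps_div (fps_exp 'X) (fun i => fps_expm1 {poly R} i.+1) n.

Definition bernoulli_num (n : nat) : R := (bernoulli_poly n).[0].

Let fact_neq0 n : n`!%:R != 0 :> R.
Proof. by rewrite pnatr_eq0 -lt0n fact_gt0. Qed.

Let fact_polyC n : n`!%:R^-1 = (n`!%:R^-1 : R)%:P :> {poly R}.
Proof. by rewrite -polyC_natr polyCV. Qed.

Let expm1E n (x : R) : (fps_expm1 {poly R} n).[x] = fps_expm1 R n.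
Proof.
rewrite /fps_expm1 /fps_exp !expr1n !mul1r fact_polyC hornerD hornerN.
by rewrite hornerC -polyC_natr hornerC.
Qed.

Let mul_z f n : fps_mul (fps_z R) f n = if n is n'.+1 then f n' else 0.
Proof.
rewrite /fps_mul /fps_z; case: n => [|n].
  by rewrite big_ord1 mul0r.
rewrite !big_ord_recl /= mul0r add0r mul1r big1 ?addr0 ?subSS ?subn0 //.
by move=> i _; rewrite mul0r.
Qed.

Let mul_expm1 f n : fps_mul f (fps_expm1 R) n =
  if n is n'.+1 then fps_mul f (fun i => fps_expm1 R i.+1) n' else 0.
Proof.
have e0 : fps_expm1 R 0 = 0 by rewrite /fps_expm1 /fps_exp expr0 fact0 divr1 subrr.
rewrite /fps_mul; case: n => [|n]; first by rewrite big_ord1 e0 mulr0.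
rewrite big_ord_recr /= subnn e0 mulr0 addr0; apply: eq_bigr => i _.
by rewrite subSn // -ltnS.
Qed.

(* sum_n B_n(x) z^n / n! * (exp z - 1) = z exp (x z), for every x. *)
Lemma bernoulli_poly_gf (x : R) :
  fps_mul (fun n => (bernoulli_poly n).[x] / n`!%:R) (fps_expm1 R)
    =1 fps_mul (fps_z R) (fps_exp x).
Proof.
move=> [|n]; rewrite mul_z mul_expm1 //.
have u : fps_expm1 {poly R} 1 \is a GRing.unit.
  by rewrite /fps_expm1 /fps_exp expr1n subr0 divr1 unitr1.
have /(_ n) := fps_mul_div (fps_exp 'X) (g := fun i => fps_expm1 {poly R} i.+1) u.
move=> /(congr1 (fun p => p.[x])).
rewrite {2}/fps_exp fact_polyC hornerM hornerXn hornerC -/(fps_exp x n) => <-.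
rewrite /fps_mul horner_sum; apply: eq_bigr => i _.
rewrite /bernoulli_poly !hornerM expm1E -polyC_natr hornerC.
by rewrite [X in X * _]mulrAC mulfV ?mul1r.
Qed.

Lemma bernoulli_poly_gf_uniq (B : nat -> {poly R}) :
  (forall x : R, fps_mul (fun n => (B n).[x] / n`!%:R) (fps_expm1 R)
    =1 fps_mul (fps_z R) (fps_exp x)) ->
  B =1 bernoulli_poly.
Proof.
move=> HB n; have e1 : fps_expm1 R 1 = 1.
  by rewrite /fps_expm1 /fps_exp expr1n subr0 divr1.
have hornerE x : (B n).[x] = (bernoulli_poly n).[x].
  elim/ltn_ind: n => n IHn.
  have := HB x n.+1; rewrite -(bernoulli_poly_gf x n.+1) !mul_expm1 /fps_mul.
  rewrite !big_ord_recr /= subnn e1 !mulr1.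
  rewrite (eq_bigr (fun i : 'I_n =>
    (bernoulli_poly i).[x] / i`!%:R * fps_expm1 R (n - i).+1)); last first.
    by move=> i _; rewrite IHn.
  by move/addrI/mulIf; apply; rewrite invr_eq0.
apply/eqP; rewrite -subr_eq0; apply/eqP.
pose p := B n - bernoulli_poly n; rewrite -/p.
apply: (@roots_geq_poly_eq0 _ p [seq i%:R | i <- iota 0 (size p)]).
- by apply/allP => x _; rewrite /root /p hornerD hornerN hornerE subrr.
- by rewrite map_inj_uniq ?iota_uniq // => i k /eqP; rewrite eqr_nat => /eqP.
- by rewrite size_map size_iota.
Qed.

End Bernoulli.

Arguments bernoulli_poly {R} n.
Arguments bernoulli_num {R} n.

(* Main.v *)
(* With x = alpha^j / L_j one has 1 - x = beta^j / L_j.  By Binet's formulas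
   each sum is a combination, with coefficients alpha^m and beta^m, of the sums
   sum_k C(n,k) B_(n-k) y^k = B_n(y) at y = x and y = 1 - x, and the reflection
   formula B_n(1 - x) = (-1)^n B_n(x) recombines the two. *)
Require Import Defs.
From mathcomp Require Import all_boot all_order all_algebra.
From mathcomp Require Import ring lra.
Set Implicit Arguments.
Unset Strict Implicit.
Unset Printing Implicit Defensive.
Import Order.TTheory GRing.Theory Num.Theory.
Local Open Scope ring_scope.

Section FormalPowerSeriesRing.
Variable A : comUnitRingType.
Implicit Types f g h : nat -> A.

Definition fps_one : nat -> A := fun n => (n == 0)%:R.

(* The substitution z := - z. *)
Definition fps_reflect f : nat -> A := fun n => (-1) ^+ n * f n.

Lemma eq_fps_mul f f' g g' :
  f =1 f' -> g =1 g' -> fps_mul f g =1 fps_mul f' g'.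
Proof. by move=> ff gg n; apply: eq_bigr => i _; rewrite ff gg. Qed.

(** Truncating both series to polynomials does not affect coefficients of the product below [N], so
    commutativity and associativity are inherited from [{poly A}]. *)
Lemma fps_mulE N f g n : (n < N)%N ->
  fps_mul f g n = ((\poly_(i < N) f i) * (\poly_(i < N) g i))`_n.
Proof.
move=> ltnN; rewrite coefM; apply: eq_bigr => i _; rewrite !coef_poly.
have leiN : (i < N)%N by apply: leq_trans ltnN.
by rewrite leiN (leq_ltn_trans (leq_subr _ _) ltnN).
Qed.

Lemma fps_mulC f g : fps_mul f g =1 fps_mul g f.
Proof. by move=> n; rewrite !(@fps_mulE n.+1) // mulrC. Qed.

Lemma fps_mulA f g h : fps_mul f (fps_mul g h) =1 fps_mul (fps_mul f g) h.
Proof.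
move=> n; pose P f' := \poly_(i < n.+1) f' i.
transitivity ((P f * (P g * P h))`_n).
  rewrite coefM; apply: eq_bigr => i _.
  rewrite coef_poly ltn_ord -fps_mulE //.
  by rewrite ltnS leq_subr.
rewrite mulrA coefM; apply: eq_bigr => i _.
by rewrite -fps_mulE // coef_poly ltnS leq_subr.
Qed.

Lemma fps_mul1 f : fps_mul f fps_one =1 f.
Proof.
move=> n; rewrite /fps_mul big_ord_recr /= subnn mulr1 big1 ?add0r // => i _.
by rewrite /fps_one subn_eq0 leqNgt ltn_ord mulr0.
Qed.

Lemma fps_mulBl f g h n :
  fps_mul (fun i => f i - g i) h n = fps_mul f h n - fps_mul g h n.
Proof. by rewrite /fps_mul -sumrB; apply: eq_bigr => i _; rewrite mulrBl. Qed.

Lemma fps_mulNl f g n : fps_mul (fun i => - f i) g n = - fps_mul f g n.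
Proof. by rewrite /fps_mul -sumrN; apply: eq_bigr => i _; rewrite mulNr. Qed.

Lemma fps_mulNr f g n : fps_mul f (fun i => - g i) n = - fps_mul f g n.
Proof. by rewrite /fps_mul -sumrN; apply: eq_bigr => i _; rewrite mulrN. Qed.

Lemma fps_reflectM f g :
  fps_reflect (fps_mul f g) =1 fps_mul (fps_reflect f) (fps_reflect g).
Proof.
move=> n; rewrite /fps_reflect /fps_mul mulr_sumr; apply: eq_bigr => i _.
by rewrite mulrACA -exprD subnKC // -ltnS.
Qed.

Lemma fps_reflect_z : fps_reflect (fps_z A) =1 fun n => - fps_z A n.
Proof.
by case=> [|[|n]]; rewrite /fps_reflect /fps_z /= ?mulr0 ?oppr0 ?expr1 ?mulN1r.
Qed.

Lemma fps_reflect_exp (x : A) : fps_reflect (fps_exp x) =1 fps_exp (- x).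
Proof. by move=> n; rewrite /fps_reflect /fps_exp mulrA -exprNn. Qed.

Lemma fps_exp0 : fps_exp (0 : A) =1 fps_one.
Proof. by case=> [|n]; rewrite /fps_exp /fps_one ?divr1 // expr0n mul0r. Qed.

End FormalPowerSeriesRing.

Section BernoulliIdentities.
Variable R : rcfType.
Implicit Types (x y : R) (f g : nat -> R).

Lemma fact_neq0 n : n`!%:R != 0 :> R.
Proof. by rewrite pnatr_eq0 -lt0n fact_gt0. Qed.

Lemma bin_div_fact n k : (k <= n)%N ->
  'C(n, k)%:R / n`!%:R = (k`!%:R)^-1 * ((n - k)`!%:R)^-1 :> R.
Proof.
move=> lekn; rewrite -(bin_fact lekn) !natrM !invfM mulVKf //.
by rewrite pnatr_eq0 -lt0n bin_gt0.
Qed.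

(** The binomial theorem divided by [n!]. *)
Lemma fps_expD x y : fps_mul (fps_exp x) (fps_exp y) =1 fps_exp (x + y).
Proof.
move=> n; rewrite /fps_mul /fps_exp addrC exprDn mulr_suml.
apply: eq_bigr => i _; have lein : (i <= n)%N by rewrite -ltnS.
transitivity (x ^+ i * y ^+ (n - i) * ('C(n, i)%:R / n`!%:R)).
  by rewrite bin_div_fact //; ring.
by rewrite -mulr_natr; ring.
Qed.

(** Expanding (e^(-z) - 1) e^z and using e^(-z) e^z = 1 leaves 1 - e^z. This trades the reflected
    denominator for the original one. *)
Lemma fps_reflect_expm1 :
  fps_mul (fps_reflect (fps_expm1 R)) (fps_exp 1)
    =1 fun n => - fps_expm1 R n.
Proof.
move=> n.
have e : fps_reflect (fps_expm1 R) =1 fun i => fps_exp (-1) i - fps_one R i.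
  move=> i; rewrite /fps_reflect mulrBr -/(fps_reflect (fps_exp 1) i).
  by rewrite fps_reflect_exp; case: i => [|i]; rewrite /fps_one ?mulr0 ?mul1r.
rewrite (eq_fps_mul e (frefl _)) fps_mulBl fps_expD addNr fps_exp0.
by rewrite fps_mulC fps_mul1 opprB.
Qed.

(** The series e^z - 1 has constant term 0, hence no inverse, but its coefficient of z is 1:
    coefficient n+1 of the product determines coefficient n of the other factor once the earlier
    ones are known. *)
Lemma fps_mul_expm1_inj f g :
  fps_mul f (fps_expm1 R) =1 fps_mul g (fps_expm1 R) -> f =1 g.
Proof.
move=> fg n; elim/ltn_ind: n => n IHn.
have e0 : fps_expm1 R 0 = 0 by rewrite /fps_expm1 /fps_exp expr1n divr1 subrr.
have e1 : fps_expm1 R 1 = 1 by rewrite /fps_expm1 /fps_exp expr1n subr0 divr1.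
have := fg n.+1; rewrite /fps_mul !big_ord_recr /= subnn subSn // subnn.
rewrite e0 e1 !mulr0 !addr0 !mulr1.
by under eq_bigr => i _ do rewrite IHn //; move/addrI.
Qed.

Definition bernoulli_egf x : nat -> R :=
  fun n => (bernoulli_poly n).[x] / n`!%:R.

(** The generating function at x is e^(xz) times the one at 0, since both become z e^(xz) after
    multiplication by e^z - 1. Comparing coefficients of z^n and clearing [n!] gives the binomial
    sum. *)
Lemma bernoulli_polyE x n :
  (bernoulli_poly n).[x]
    = \sum_(k < n.+1) 'C(n, k)%:R * x ^+ k * bernoulli_num (n - k).
Proof.
have H : fps_mul (fps_exp x) (bernoulli_egf 0) =1 bernoulli_egf x.
  apply: fps_mul_expm1_inj => i.
  rewrite -fps_mulA (eq_fps_mul (frefl _) (bernoulli_poly_gf 0)).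
  rewrite (eq_fps_mul (frefl _) (eq_fps_mul (frefl _) (@fps_exp0 R))).
  rewrite (eq_fps_mul (frefl _) (fps_mul1 _)) fps_mulC.
  by rewrite bernoulli_poly_gf.
apply: (mulIf (invr_neq0 (fact_neq0 n))).
rewrite -[LHS](H n) mulr_suml; apply: eq_bigr => i _.
have lein : (i <= n)%N by rewrite -ltnS.
rewrite /fps_exp /bernoulli_egf /bernoulli_num.
transitivity ('C(n, i)%:R / n`!%:R * x ^+ i * (bernoulli_poly (n - i)).[0]).
  by rewrite bin_div_fact //; ring.
by ring.
Qed.

(** Substituting -z for z in z e^((1-x)z) / (e^z - 1) gives -z e^((x-1)z) / (e^(-z) - 1), which is z
    e^(xz) / (e^z - 1) after multiplying top and bottom by e^z. *)
Lemma bernoulli_poly_reflect x n :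
  (bernoulli_poly n).[1 - x] = (-1) ^+ n * (bernoulli_poly n).[x].
Proof.
have H : fps_reflect (bernoulli_egf (1 - x)) =1 bernoulli_egf x.
  apply: fps_mul_expm1_inj => i.
  (* Writing e^z - 1 as -(e^(-z) - 1) e^z puts the reflected denominator next to the reflected
     series, so that the reflected defining identity [eR] applies. *)
  have eE : fps_expm1 R =1
      fun n => - fps_mul (fps_reflect (fps_expm1 R)) (fps_exp 1) n.
    by move=> k; rewrite fps_reflect_expm1 opprK.
  rewrite (eq_fps_mul (frefl _) eE) fps_mulNr fps_mulA.
  have eR : fps_mul (fps_reflect (bernoulli_egf (1 - x)))
      (fps_reflect (fps_expm1 R)) =1
      fun k => - fps_mul (fps_z R) (fps_exp (x - 1)) k.
    move=> k; rewrite -fps_reflectM /fps_reflect bernoulli_poly_gf.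
    rewrite -/(fps_reflect (fps_mul _ _) k) fps_reflectM.
    rewrite (eq_fps_mul (@fps_reflect_z R) (fps_reflect_exp _)) fps_mulNl.
    by rewrite opprB.
  rewrite (eq_fps_mul eR (frefl _)) fps_mulNl opprK -fps_mulA.
  by rewrite (eq_fps_mul (frefl _) (fps_expD _ _)) subrK bernoulli_poly_gf.
(* The sign is its own inverse; multiplying by it moves it to the left-hand side, where [H] has
   it. *)
apply: (can_inj (signrMK n)); rewrite signrMK.
apply: (mulIf (invr_neq0 (fact_neq0 n))).
by rewrite -mulrA; apply: H.
Qed.

End BernoulliIdentities.

Section GoldenRatio.
Variable R : rcfType.
Local Notation alpha := (@alpha R).
Local Notation beta := (@beta R).

Lemma sqrt5_gt0 : 0 < Num.sqrt 5 :> R.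
Proof. by rewrite sqrtr_gt0 ltr0n. Qed.

Lemma alpha_mul_beta : alpha * beta = -1.
Proof.
have s5 : Num.sqrt 5 ^+ 2 = 5 :> R by rewrite sqr_sqrtr // ler0n.
transitivity ((1 - Num.sqrt 5 ^+ 2) / 4 : R); last by rewrite s5; field.
by rewrite /alpha /beta; field.
Qed.

Lemma alpha_gt1 : 1 < alpha.
Proof.
have s1 : 1 < Num.sqrt 5 :> R by rewrite -[ltLHS]sqrtr1 ltr_sqrt ?ltr1n ?ltr0n.
by rewrite /alpha; lra.
Qed.

Lemma alpha_neq0 : alpha != 0.
Proof. by rewrite gt_eqF // (lt_trans ltr01 alpha_gt1). Qed.

Lemma beta_neq0 : beta != 0.
Proof.
by apply: contra_eq_neq alpha_mul_beta => ->; rewrite mulr0 eq_sym oppr_eq0 oner_eq0.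
Qed.

(* L_j = 0 would give alpha^(2j) = - (alpha beta)^j = ±1, hence j = 0. *)
Lemma lucasz_neq0 (j : int) : lucasz j != 0 :> R.
Proof.
apply/eqP => /(canRL (addrK _)); rewrite add0r => ab.
have a0 : 0 < alpha := lt_trans ltr01 alpha_gt1.
have E : alpha ^ j * alpha ^ j = - ((-1) ^ j).
  by rewrite {2}ab mulrN -exprzMl ?unitfE ?alpha_neq0 ?beta_neq0 // alpha_mul_beta.
have aj : alpha ^ j = 1.
  have aj0 : 0 < alpha ^ j by apply: exprz_gt0.
  (* The square is positive, so it equals its absolute value, in which the sign of (-1)^j
     disappears. *)
  apply/eqP; rewrite -(@pexpr_eq1 _ _ 2) ?ltW // expr2 -[_ * _]gtr0_norm.
    by rewrite E normrN expN1r normr_sign.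
  exact: mulr_gt0.
have j0 : j = 0.
  by apply: (ieexprIz a0); rewrite ?expr0z // gt_eqF // alpha_gt1.
by move: ab; rewrite j0 !expr0z; lra.
Qed.

Lemma one_sub_alpha_lucasz (j : int) :
  1 - alpha ^ j / lucasz j = beta ^ j / lucasz j.
Proof.
by rewrite -{1}(divff (lucasz_neq0 j)) -mulrBl /lucasz addrAC subrr add0r.
Qed.

End GoldenRatio.

(** Treats one Binet term at a time, for [a] equal to [alpha] or [beta] and [l] to L_j. As [a] is
    nonzero, a^(jk+m) splits into a^m and (a^j)^k even for negative exponents, and [bernoulli_polyE]
    sums the rest. *)
Lemma bernoulli_exp_sum (R : rcfType) (a l : R) (j m : int) (n : nat) :
  a != 0 ->
  \sum_(k < n.+1)
      'C(n, k)%:R * (a ^ (j * k%:Z + m) / l ^+ k) * bernoulli_num (n - k)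
    = a ^ m * (bernoulli_poly n).[a ^ j / l].
Proof.
move=> a0; rewrite bernoulli_polyE mulr_sumr; apply: eq_bigr => k _.
rewrite expfzDr // -exprz_exp -exprnP expr_div_n; ring.
Qed.

Theorem theorem11 (R : rcfType) (j m : int) (n : nat) :
  \sum_(k < n.+1) 'C(n, k)%:R * (fibz (j * k%:Z + m) / lucasz j ^+ k)
      * bernoulli_num (n - k)
    = (if ~~ odd n
       then fibz m * (bernoulli_poly n).[alpha ^ j / lucasz j]
       else lucasz m / Num.sqrt 5 * (bernoulli_poly n).[alpha ^ j / lucasz j])
      :> R
  /\
  \sum_(k < n.+1) 'C(n, k)%:R * (lucasz (j * k%:Z + m) / lucasz j ^+ k)
      * bernoulli_num (n - k)
    = (if ~~ odd n
       then lucasz m * (bernoulli_poly n).[alpha ^ j / lucasz j]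
       else Num.sqrt 5 * fibz m * (bernoulli_poly n).[alpha ^ j / lucasz j])
      :> R.
Proof.
have s5 : Num.sqrt 5 != 0 :> R by rewrite gt_eqF // sqrt5_gt0.
have Sa := bernoulli_exp_sum (lucasz j) j m n (alpha_neq0 R).
have := bernoulli_exp_sum (lucasz j) j m n (beta_neq0 R).
(* Both sums are now multiples of the same Bernoulli value, and the sign depends on [odd n] only,
   ready for the case split. *)
rewrite -one_sub_alpha_lucasz bernoulli_poly_reflect -signr_odd => Sb.
split.
  transitivity ((alpha ^ m * (bernoulli_poly n).[alpha ^ j / lucasz j]
    - beta ^ m * ((-1) ^+ odd n * (bernoulli_poly n).[alpha ^ j / lucasz j]))
    / Num.sqrt 5 :> R).
    rewrite -Sa -Sb -sumrB mulr_suml; apply: eq_bigr => k _.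
    by rewrite /fibz; ring.
  (* The parity sign turns alpha^m - beta^m into alpha^m + beta^m when n is odd. Only [lucasz m] is
     unfolded, so [lucasz j] stays an atom. *)
  by rewrite /fibz [lucasz m]/lucasz; case: (odd n) => /=; rewrite ?expr0 ?expr1; ring.
transitivity (alpha ^ m * (bernoulli_poly n).[alpha ^ j / lucasz j]
    + beta ^ m * ((-1) ^+ odd n * (bernoulli_poly n).[alpha ^ j / lucasz j]) :> R).
  rewrite -Sa -Sb -big_split; apply: eq_bigr => k _.
  by rewrite /= [lucasz (_ + _)]/lucasz; ring.
rewrite /fibz [lucasz m]/lucasz; case: (odd n) => /=; rewrite ?expr0 ?expr1.
  (* In the odd case the square root of 5 must cancel against the denominator of [fibz m], which
     uses [s5]. *)
  by field.
by ring.
Qed.
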